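(* Let $P=G(K_{\mathbb X})$ and $Q=H(K_{\mathbb Y})$ be LISC cones belonging to $\mathcal C(\mathbb V)$, and consider the fractional program $$\text{(FP)}\quad \min\ \Phi(x,y):=\frac{\langle Gx,Hy\rangle}{\|Gx\|\,\|Hy\|}\quad\text{s.t. } x\in K_{\mathbb X},\ \langle e_{\mathbb X},x\rangle=1,\ y\in K_{\mathbb Y},\ \langle e_{\mathbb Y},y\rangle=1 .$$ If $(\tilde x,\tilde y)$ is a stationary point (resp., a solution) of (FP), then $(u,v):=\left(\frac{G\tilde x}{\|G\tilde x\|},\frac{H\tilde y}{\|H\tilde y\|}\right)$ is a critical (resp., antipodal) pair of $(P,Q)$. Conversely, if $(u,v)$ is a critical (resp., antipodal) pair of $(P,Q)$, then there exists a stationary point $(\tilde x,\tilde y)$ of (FP) such that $(u,v)=\left(\frac{G\tilde x}{\|G\tilde x\|},\frac{H\tilde y}{\|H\tilde y\|}\right)$.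
   Context: A Euclidean Jordan algebra (EJA) is a finite-dimensional real inner product space $\mathbb X$ with a commutative bilinear product $\circ$ satisfying the Jordan identity $x\circ(x^2\circ y)=x^2\circ(x\circ y)$ (where $x^2=x\circ x$), with $\langle x\circ y,z\rangle=\langle y,x\circ z\rangle$ for all $x,y,z$, and with a unit element $e_{\mathbb X}$. Its symmetric cone is $K_{\mathbb X}=\{x\circ x: x\in\mathbb X\}$ (it is self-dual). An idempotent is $c$ with $c\circ c=c$; it is primitive if nonzero and not the sum of two nonzero idempotents. All EJAs are assumed scalarizable: there is $\kappa>0$ with $\langle x,y\rangle=\kappa\,\mathrm{tr}(x\circ y)$ for all $x,y$, where $\mathrm{tr}$ is the sum of the eigenvalues in the spectral decomposition. $\mathbb V$ is a (finite-dimensional) Euclidean space; $\mathcal C(\mathbb V)$ is the set of closed convex cones $K\subseteq\mathbb V$ with $K\ne\{0\}$, $K\ne\mathbb V$; $K^*=\{\zeta:\langle\zeta,u\rangle\ge0\ \forall u\in K\}$ is the dual cone. A closed convex cone $P\subseteq \mathbb V$ is a LISC cone, represented as $P=G(K_{\mathbb X})$, if $\mathbb X$ is an EJA and $G:\mathbb X\to\mathbb V$ is linear with $G(K_{\mathbb X})=P$, $G(c)\neq0$ for every primitive idempotent $c\in\mathbb X$, and $P\cap(-P)=\{0\}$. Likewise $Q=H(K_{\mathbb Y})$ with $H:\mathbb Y\to\mathbb V$ linear. Then $Gx\ne0$ for $x\in K_{\mathbb X}\setminus\{0\}$ and $Hy\neq 0$ for $y\in K_{\mathbb Y}\setminus\{0\}$.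 An antipodal pair of $(P,Q)$ is a (global) minimizer $(u,v)$ of $\langle u,v\rangle$ subject to $u\in P$, $\|u\|=1$, $v\in Q$, $\|v\|=1$. A critical pair of $(P,Q)$ is a pair $(u,v)$ with $u\in P$, $\|u\|=1$, $v\in Q$, $\|v\|=1$, $v-\langle u,v\rangle u\in P^*$, $u-\langle u,v\rangle v\in Q^*$. Stationarity: $(\bar x,\bar y)$ is a stationary point of $\min \Psi(x,y)$ s.t. $x\in K_{\mathbb X},\ \phi_1(x)=0,\ y\in K_{\mathbb Y},\ \phi_2(y)=0$ if there exist $\gamma_1,\gamma_2\in\mathbb R$ such that $\bar x\in K_{\mathbb X}$, $\nabla_x\Psi(\bar x,\bar y)+\gamma_1\nabla\phi_1(\bar x)\in K_{\mathbb X}^*$, these two are orthogonal; $\bar y\in K_{\mathbb Y}$, $\nabla_y\Psi(\bar x,\bar y)+\gamma_2\nabla\phi_2(\bar y)\in K_{\mathbb Y}^*$, these two are orthogonal; and $\phi_1(\bar x)=0=\phi_2(\bar y)$. For (FP), $\Psi=\Phi$, $\phi_1(x)=\langle e_{\mathbb X},x\rangle-1$, $\phi_2(y)=\langle e_{\mathbb Y},y\rangle-1$. A solution means a global minimizer. *)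

(* Defs.v *)
From HB Require Import structures.
From mathcomp Require Import all_boot all_order all_algebra sesquilinear.
From mathcomp Require Import all_classical all_reals all_analysis.
Set Implicit Arguments.
Unset Strict Implicit.
Unset Printing Implicit Defensive.
Import Order.TTheory GRing.Theory Num.Theory.
Import numFieldNormedType.Exports.
Local Open Scope classical_set_scope.
Local Open Scope ring_scope.

(* Finite-dimensional real inner product spaces. The norm, hence the topology
   and the differential calculus, is the one induced by the inner product. *)
HB.mixin Record isEuclidean (R : realType) V
    of NormedModule R V & Vector R V := {
  inner : {dot V for (idfun : R -> R)} ;
  inner_normE : forall x : V, inner x x = `|x| ^+ 2
}.

#[short(type="euclideanType")]
HB.structure Definition Euclidean (R : realType) :=
  {V of NormedModule R V & Vector R V & isEuclidean R V}.

HB.mixin Record isEuclideanJordan (R : realType) X of Euclidean R X := {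
  jmul : {bilinear X -> X -> X} ;
  junit : X ;
  jmulC : forall x y : X, jmul x y = jmul y x ;
  jmul_jordan : forall x y : X,
    jmul x (jmul (jmul x x) y) = jmul (jmul x x) (jmul x y) ;
  jmul_inner : forall x y z : X, inner (jmul x y) z = inner y (jmul x z) ;
  jmul1 : forall x : X, jmul junit x = x
}.

#[short(type="ejaType")]
HB.structure Definition EuclideanJordan (R : realType) :=
  {X of Euclidean R X & isEuclideanJordan R X}.

Section JordanAlgebra.
Context {R : realType} {X : ejaType R}.
Local Notation "x '\jp' y" := (jmul x y) (at level 40, left associativity).

Definition symmetric_cone : set X := [set x \jp x | x in setT].

Definition jidempotent (c : X) : Prop := c \jp c = c.

Definition jprimitive (c : X) : Prop :=
  [/\ jidempotent c, c <> 0 &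
      ~ exists a b : X,
          [/\ jidempotent a, a <> 0, jidempotent b, b <> 0 & c = a + b]].

Definition jordan_frame n (c : 'I_n -> X) : Prop :=
  [/\ forall i, jprimitive (c i),
      forall i j, i != j -> c i \jp c j = 0 &
      \sum_(i < n) c i = junit].

Definition spectral_decomposition n (c : 'I_n -> X) (lam : 'I_n -> R) (x : X)
    : Prop :=
  jordan_frame c /\ x = \sum_(i < n) lam i *: c i.

(* [t] is the sum of the eigenvalues, counted with multiplicity, in the
   spectral decomposition of [x]. By the spectral theorem each [x] has exactly
   one such [t]. *)
Definition jtrace_spec (x : X) (t : R) : Prop :=
  exists n (c : 'I_n -> X) (lam : 'I_n -> R),
    spectral_decomposition c lam x /\ t = \sum_(i < n) lam i.

End JordanAlgebra.
Arguments symmetric_cone {R} X.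

Definition scalarizable (R : realType) (X : ejaType R) : Prop :=
  exists2 kappa : R, 0 < kappa &
    forall (x y : X) (t : R),
      jtrace_spec (jmul x y) t -> inner x y = kappa * t.

Section Cones.
Context {R : realType} {V : euclideanType R}.

Definition closed_convex_cone (K : set V) : Prop :=
  [/\ closed K, convex_set (K : set (convex_lmodType V)), K !=set0 &
      forall (t : R) (u : V), 0 <= t -> K u -> K (t *: u)].

Definition nontrivial_closed_convex_cone (K : set V) : Prop :=
  [/\ closed_convex_cone K, K <> [set 0] & K <> setT].

Definition dual_cone (K : set V) : set V :=
  [set z | forall u, K u -> 0 <= inner z u].

Definition normalize (u : V) : V := `|u|^-1 *: u.

Definition unit_pair (P Q : set V) (u v : V) : Prop :=
  [/\ P u, `|u| = 1, Q v & `|v| = 1].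

Definition antipodal_pair (P Q : set V) (u v : V) : Prop :=
  unit_pair P Q u v /\
  forall u' v', unit_pair P Q u' v' -> inner u v <= inner u' v'.

Definition critical_pair (P Q : set V) (u v : V) : Prop :=
  [/\ unit_pair P Q u v,
      dual_cone P (v - inner u v *: u) &
      dual_cone Q (u - inner u v *: v)].

Definition is_gradient (f : V -> R) (x g : V) : Prop := is_diff x f (inner g).

End Cones.

Definition LISC_cone (R : realType) (X : ejaType R) (V : euclideanType R)
    (G : {linear X -> V}) (P : set V) : Prop :=
  [/\ closed_convex_cone P,
      P = G @` symmetric_cone X,
      forall c : X, jprimitive c -> G c <> 0 &
      P `&` [set - u | u in P] = [set 0]].

Section Program.
Context {R : realType} {X Y : ejaType R}.
Variables (Psi : X -> Y -> R) (phi1 : X -> R) (phi2 : Y -> R).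

Definition feasible (x : X) (y : Y) : Prop :=
  [/\ symmetric_cone X x, phi1 x = 0, symmetric_cone Y y & phi2 y = 0].

Definition program_solution (x : X) (y : Y) : Prop :=
  feasible x y /\ forall x' y', feasible x' y' -> Psi x y <= Psi x' y'.

(* [gx], [gy] are the partial gradients of [Psi] at [(x, y)], and [d1], [d2]
   the gradients of the constraint functions. *)
Definition stationary_point (x : X) (y : Y) : Prop :=
  exists (gamma1 gamma2 : R) (gx d1 : X) (gy d2 : Y),
    [/\ [/\ is_gradient (Psi^~ y) x gx, is_gradient phi1 x d1,
            is_gradient (Psi x) y gy & is_gradient phi2 y d2],
        [/\ symmetric_cone X x, dual_cone (symmetric_cone X) (gx + gamma1 *: d1)
          & inner x (gx + gamma1 *: d1) = 0],
        [/\ symmetric_cone Y y, dual_cone (symmetric_cone Y) (gy + gamma2 *: d2)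
          & inner y (gy + gamma2 *: d2) = 0] &
        phi1 x = 0 /\ phi2 y = 0].

End Program.

Section FractionalProgram.
Context {R : realType} {X Y : ejaType R} {V : euclideanType R}.
Variables (G : {linear X -> V}) (H : {linear Y -> V}).

Definition FP_objective (x : X) (y : Y) : R :=
  inner (G x) (H y) / (`|G x| * `|H y|).

Definition FP_stationary : X -> Y -> Prop :=
  stationary_point FP_objective (fun x => inner junit x - 1)
                                (fun y => inner junit y - 1).

Definition FP_solution : X -> Y -> Prop :=
  program_solution FP_objective (fun x => inner junit x - 1)
                                (fun y => inner junit y - 1).

End FractionalProgram.

(* Main.v *)
From HB Require Import structures.
Require Import Defs.
From mathcomp Require Import all_boot all_order all_algebra sesquilinear.
From mathcomp Require Import all_classical all_reals all_analysis.
From mathcomp Require Import ring lra complex.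
Set Implicit Arguments.
Unset Strict Implicit.
Import Order.TTheory GRing.Theory Num.Theory.
Import numFieldNormedType.Exports.
Local Open Scope ring_scope.

(** The ratio [Phi] is homogeneous of degree zero in each variable, so pairing a
    stationarity condition with the point itself kills the multiplier, and what
    remains of the condition, transported by [G] and [H], is criticality. This
    needs [G x <> 0] for every nonzero [x = z^2] in the symmetric cone. Powers of
    [z] associate and there are no nontrivial vanishing sums of squares, so [z] has
    an eigenvector in [R[z]] with nonzero real eigenvalue; this gives a nonzero
    idempotent [c] and a [t > 0] with [x - t c] a square. If [G x = 0],
    pointedness of [P] gives [G c = 0], and again for every idempotent summand of
    [c]; splitting off summands terminates because the norms of nonzero idempotents
    are bounded away from zero, and it ends at a primitive idempotent killed by
    [G]. Antipodal pairs are critical by a first-order expansion of the norm. *)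

(** Inclusion-exclusion over the partial sums of [a], [b], [c] keeps only the terms containing all
    three arguments; by symmetry in the last two slots each occurs twice, and 2 is invertible. *)
Lemma cubic_polarization (R : realType) (V : zmodType) (T : V -> V -> V -> R) :
  (forall u u' v w, T (u + u') v w = T u v w + T u' v w) ->
  (forall u v v' w, T u (v + v') w = T u v w + T u v' w) ->
  (forall u v w, T u v w = T u w v) ->
  (forall u, T u u u = 0) ->
  forall a b c, T a b c + T b a c + T c a b = 0.
Proof.
move=> D1 D2 S D0 a b c.
have D3 u v w w' : T u v (w + w') = T u v w + T u v w'.
  by rewrite S D2 S (S _ w').
have := D0 (a + b + c); have := D0 (a + b); have := D0 (b + c).
have := D0 (a + c); have := D0 a; have := D0 b; have := D0 c.
rewrite !(D1, D2, D3) (S a c b) (S b c a) (S c b a) !(S _ b a) !(S _ c a) !(S _ c b).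
lra.
Qed.

(** * Inner product calculus and the Cauchy-Schwarz inequality *)

Section Inner.
Context {R : realType} {V : euclideanType R}.
Implicit Types u v w : V.

Lemma innerC u v : inner u v = inner v u.
Proof. by rewrite (hermC inner) expr0 mul1r. Qed.

Lemma innerDl u v w : inner (u + v) w = inner u w + inner v w.
Proof. exact: linearDl. Qed.
Lemma innerDr u v w : inner w (u + v) = inner w u + inner w v.
Proof. exact: linearDr. Qed.
Lemma innerZl a u w : inner (a *: u) w = a * inner u w.
Proof. exact: linearZl_LR. Qed.
Lemma innerZr a u w : inner w (a *: u) = a * inner w u.
Proof. by rewrite innerC innerZl innerC. Qed.
Lemma innerNl u w : inner (- u) w = - inner u w.
Proof. exact: linearNl. Qed.
Lemma innerNr u w : inner w (- u) = - inner w u.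
Proof. exact: linearNr. Qed.
Lemma inner0l w : inner 0 w = 0. Proof. exact: linear0l. Qed.
Lemma inner0r w : inner w 0 = 0. Proof. exact: linear0r. Qed.
Lemma inner_sumr I (r : seq I) (F : I -> V) w :
  inner w (\sum_(i <- r) F i) = \sum_(i <- r) inner w (F i).
Proof. exact: linear_sumr. Qed.
Lemma inner_suml I (r : seq I) (F : I -> V) w :
  inner (\sum_(i <- r) F i) w = \sum_(i <- r) inner (F i) w.
Proof. exact: linear_sumlz. Qed.

Definition innerE :=
  (innerDl, innerDr, innerNl, innerNr, innerZl, innerZr, inner0l, inner0r).

Lemma inner_ge0 u : 0 <= inner u u.
Proof. by rewrite inner_normE sqr_ge0. Qed.

Lemma inner_eq0 u : (inner u u == 0) = (u == 0).
Proof. by rewrite inner_normE sqrf_eq0 normr_eq0. Qed.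

Lemma inner_inj u v : (forall w, inner u w = inner v w) -> u = v.
Proof.
move=> uv; apply/eqP; rewrite -subr_eq0 -inner_eq0 innerDl innerNl uv.
by rewrite subrr.
Qed.

Lemma inner_le_norm u v : inner u v <= `|u| * `|v|.
Proof.
have [->|u0] := eqVneq u 0; first by rewrite inner0l normr0 mul0r.
have [->|v0] := eqVneq v 0; first by rewrite inner0r normr0 mulr0.
have nu : 0 < `|u| by rewrite normr_gt0.
have nv : 0 < `|v| by rewrite normr_gt0.
(* This square expands to [2 |u| |v| (|u| |v| - <u,v>)]. *)
have := inner_ge0 (`|v| *: u - `|u| *: v).
rewrite !innerE !inner_normE (innerC v u) => h.
rewrite -(ler_pM2l (mulr_gt0 nu nv)); nra.
Qed.

Lemma norm_inner_le u v : `|inner u v| <= `|u| * `|v|.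
Proof.
rewrite ler_norml inner_le_norm andbT lerNl -innerNl.
by rewrite (le_trans (inner_le_norm _ _)) // normrN.
Qed.
End Inner.

(** * Linearization of the Jordan identity *)

Section Jordan.
Context {R : realType} {X : ejaType R}.
Implicit Types a b c x y z : X.
Local Notation "x '\jp' y" := (jmul x y) (at level 40, left associativity).

Lemma jmulDl x y z : (x + y) \jp z = x \jp z + y \jp z.
Proof. exact: linearDl. Qed.
Lemma jmulDr x y z : z \jp (x + y) = z \jp x + z \jp y.
Proof. exact: linearDr. Qed.
Lemma jmulZl (t : R) x z : (t *: x) \jp z = t *: (x \jp z).
Proof. exact: linearZl_LR. Qed.
Lemma jmulZr (t : R) x z : z \jp (t *: x) = t *: (z \jp x).
Proof. by rewrite jmulC jmulZl jmulC. Qed.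
Lemma jmulNl x z : (- x) \jp z = - (x \jp z).
Proof. exact: linearNl. Qed.
Lemma jmulNr x z : z \jp (- x) = - (z \jp x).
Proof. exact: linearNr. Qed.
Lemma jmul0l z : 0 \jp z = 0. Proof. exact: linear0l. Qed.
Lemma jmul0r z : z \jp 0 = 0. Proof. exact: linear0r. Qed.
Lemma jmulx1 x : x \jp junit = x. Proof. by rewrite jmulC jmul1. Qed.

Definition jmulE :=
  (jmulDl, jmulDr, jmulNl, jmulNr, jmulZl, jmulZr, jmul0l, jmul0r).

(** For fixed [y] the Jordan identity is cubic in its other variable. Pairing with an arbitrary [w]
    makes it scalar, so that [cubic_polarization] applies. *)
Lemma jordan_polarized a b c y :
  a \jp ((b \jp c) \jp y) + b \jp ((a \jp c) \jp y) + c \jp ((a \jp b) \jp y) =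
  (b \jp c) \jp (a \jp y) + (a \jp c) \jp (b \jp y) + (a \jp b) \jp (c \jp y).
Proof.
apply: inner_inj => w.
pose T u v z := inner (u \jp ((v \jp z) \jp y)) w
              - inner ((v \jp z) \jp (u \jp y)) w.
have regroup (p1 p2 p3 q1 q2 q3 : R) :
    p1 + p2 + p3 - (q1 + q2 + q3) = (p1 - q1) + (p2 - q2) + (p3 - q3) by ring.
apply/eqP; rewrite -subr_eq0 !innerDl regroup; apply/eqP.
apply: (@cubic_polarization R X T); rewrite /T.
- by move=> u u' v z; rewrite !jmulDl jmulDr !innerDl opprD addrACA.
- by move=> u v v' z; rewrite !(jmulDl, jmulDr) !innerDl opprD addrACA.
- by move=> u v z; rewrite (jmulC v).
- by move=> u; rewrite jmul_jordan subrr.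
Qed.

(* As an operator identity in [c], this expresses multiplication by [d (a b)]
   through multiplications by products of fewer factors. *)
Lemma jmul_rec a b d c :
  (d \jp (a \jp b)) \jp c =
  (a \jp d) \jp (b \jp c) + (b \jp d) \jp (a \jp c) + (a \jp b) \jp (d \jp c)
  - a \jp (d \jp (b \jp c)) - b \jp (d \jp (a \jp c)).
Proof.
have := jordan_polarized a b c d.
rewrite (jmulC _ d) (jmulC (a \jp c) d) (jmulC (a \jp b) d).
rewrite (jmulC (b \jp c) (a \jp d)) (jmulC (a \jp c) (b \jp d)).
rewrite (jmulC c (d \jp _)) (jmulC c d) => <-.
by rewrite -addrA -opprD addrC addKr.
Qed.
End Jordan.

(** Take a complex root [a + ib]. If [b] is nonzero, the remainder of [p] modulo the real quadratic
    with this root has degree at most 1 and vanishes at a non-real point, so it is zero. *)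
Lemma real_poly_factor (R : rcfType) (p : {poly R}) : (1 < size p)%N ->
  (exists a : R, root p a) \/
  (exists a b : R, b != 0 /\ ('X - a%:P) ^+ 2 + (b ^+ 2)%:P %| p).
Proof.
move=> p1.
have [|[a b] rt] := closed_rootP (map_poly (real_complex R) p) _.
  by rewrite size_map_poly neq_ltn p1 orbT.
have [b0|b0] := eqVneq b 0.
  left; exists a; move: rt; rewrite b0 -[(a +i* 0)%C]/(real_complex R a).
  by rewrite fmorph_root.
right; exists a, b; split=> //.
set q := (X in X %| p).
have qs : size q = 3.
  rewrite /q size_polyDl ?size_exp_XsubC // size_polyC.
  by case: eqP.
have q0 : q != 0 by rewrite -size_poly_eq0 qs.
have rq : (map_poly (real_complex R) q).[(a +i* b)%C] = 0.
  rewrite /q rmorphD rmorphXn rmorphB /= map_polyX !map_polyC /= !hornerE /=.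
  by apply/eqP; rewrite eq_complex /=; apply/andP; split; apply/eqP; ring.
have rr : (map_poly (real_complex R) (p %% q)).[(a +i* b)%C] = 0.
  move: rt; rewrite {1}(divp_eq p q) rmorphD rmorphM /= rootE hornerD hornerM.
  by rewrite rq mulr0 add0r => /eqP.
have rs : (size (p %% q)%R <= 2)%N by have := ltn_modp p q; rewrite q0 qs.
rewrite /dvdp; move: rr rs; set r := p %% q => rr rs.
have rE : r = (r`_1) *: 'X + (r`_0)%:P.
  apply/polyP => -[|[|i]]; rewrite coefD coefZ coefX coefC /=
    ?mulr0 ?mulr1 ?add0r ?addr0 //.
  by rewrite nth_default // (leq_trans rs).
move: rr; rewrite rE rmorphD /= linearZ /= map_polyX map_polyC /= !hornerE.
move/eqP; rewrite eq_complex /= => /andP[/eqP h1 /eqP h2].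
have /eqP r1b : r`_1 * b = 0 by lra.
rewrite mulf_eq0 (negPf b0) orbF in r1b; rewrite (eqP r1b) in h1 *.
have -> : r`_0 = 0 by lra.
by rewrite scale0r add0r polyC0.
Qed.

(** * Power associativity, eigenvectors in [R[z]], and idempotents *)

Section Powers.
Context {R : realType} {X : ejaType R}.
Implicit Types a b c x y z : X.
Local Notation "x '\jp' y" := (jmul x y) (at level 40, left associativity).

Definition jpow z n : X := iter n (jmul z) junit.

(** By [jmul_rec], multiplication by [z^(n+2)] is a polynomial in the multiplications by [z], [z^2],
    [z^n] and [z^(n+1)]. Hence the induction carries two consecutive exponents; its base is the
    Jordan identity. *)
Lemma jpow_comm2 z n :
  (forall y, jpow z n \jp (z \jp y) = z \jp (jpow z n \jp y)) /\
  (forall y, jpow z n \jp ((z \jp z) \jp y) = (z \jp z) \jp (jpow z n \jp y)).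
Proof.
suff [//] : ((forall y, jpow z n \jp (z \jp y) = z \jp (jpow z n \jp y)) /\
  (forall y, jpow z n \jp ((z \jp z) \jp y) = (z \jp z) \jp (jpow z n \jp y)))
  /\ ((forall y, jpow z n.+1 \jp (z \jp y) = z \jp (jpow z n.+1 \jp y)) /\
  (forall y, jpow z n.+1 \jp ((z \jp z) \jp y) = (z \jp z) \jp (jpow z n.+1 \jp y))).
elim: n => [|n [[A1 A2] [B1 B2]]].
  rewrite /jpow /= jmulx1; split; split=> y; rewrite ?jmul1 //.
  by rewrite jmul_jordan.
split=> //.
have E y : jpow z n.+2 \jp y = (z \jp z) \jp (jpow z n \jp y)
    + jpow z n.+1 \jp (z \jp y) + jpow z n.+1 \jp (z \jp y)
    - z \jp (z \jp (jpow z n \jp y)) - jpow z n \jp (z \jp (z \jp y)).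
  by rewrite /jpow /= jmul_rec (jmulC _ z).
by split=> y; rewrite !E !jmulE ?(A1, A2, B1, B2, jmul_jordan).
Qed.

Definition jev z (p : {poly R}) : X := \sum_(i < size p) p`_i *: jpow z i.

Lemma jevE z (p : {poly R}) n : (size p <= n)%N ->
  jev z p = \sum_(i < n) p`_i *: jpow z i.
Proof.
move=> pn; rewrite /jev (big_ord_widen _ (fun i => p`_i *: jpow z i) pn).
rewrite big_mkcond; apply: eq_bigr => i _; case: ltnP => // h.
by rewrite nth_default // scale0r.
Qed.

Lemma jevD z p q : jev z (p + q) = jev z p + jev z q.
Proof.
pose n := maxn (size p) (size q).
rewrite !(@jevE z _ n) ?leq_maxl ?leq_maxr ?size_polyD // -big_split /=.
by apply: eq_bigr => i _; rewrite coefD scalerDl.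
Qed.

Lemma jevC z t : jev z t%:P = t *: junit.
Proof. by rewrite (@jevE z _ 1) ?size_polyC_leq1 // big_ord1 coefC. Qed.

Lemma jevXM z p : jev z (p * 'X) = z \jp jev z p.
Proof.
rewrite (@jevE z _ (size p).+1); last first.
  by have [->|p0] := eqVneq p 0; rewrite ?mul0r ?size_poly0 // size_mulX.
rewrite big_ord_recl coefMX /= scale0r add0r /jev (linear_sumr jmul).
by apply: eq_bigr => i _; rewrite coefMX /= jmulZr.
Qed.

Lemma jev_comm z p y : jev z p \jp (z \jp y) = z \jp (jev z p \jp y).
Proof.
rewrite /jev !(linear_sumlz jmul) (linear_sumr jmul); apply: eq_bigr => i _.
by rewrite !jmulE (jpow_comm2 z i).1.
Qed.

(** Power associativity: peel factors [X] off [p], moving each [z] outwards by [jev_comm]. *)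
Lemma jevM z p q : jev z (p * q) = jev z p \jp jev z q.
Proof.
elim/poly_ind: p => [|p c IH].
  by rewrite mul0r -polyC0 jevC scale0r jmul0l.
rewrite mulrDl -mulrA (mulrC 'X) mulrA !jevD !jevXM IH jmulDl jevC.
rewrite jmulZl jmul1 (jmulC (_ \jp _)) jev_comm (jmulC (jev z p)); congr (_ + _).
rewrite -[in LHS](alg_polyC) -scalerAl mul1r.
rewrite (@jevE _ (c *: q) (size q)) ?size_scale_leq // /jev scaler_sumr.
by apply: eq_bigr => i _; rewrite coefZ scalerA.
Qed.

Lemma jevZ z t p : jev z (t *: p) = t *: jev z p.
Proof. by rewrite -mul_polyC jevM jevC jmulZl jmul1. Qed.

Lemma jevX z : jev z 'X = z.
Proof. by rewrite -[X in jev z X]mul1r jevXM -polyC1 jevC scale1r jmulx1. Qed.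

(** One more power than the dimension of the space gives a linear dependence. *)
Lemma jev_annul z : exists2 p : {poly R}, p != 0 & jev z p = 0.
Proof.
pose n := (\dim {:X}).+1; pose s := [tuple jpow z i | i < n].
have nf : ~~ free s.
  apply/negP => /eqP; rewrite size_tuple => h.
  by have := dimvS (subvf (span s)); rewrite h ltnn.
have [k [ks [i ki]]] : exists k : 'I_n -> R,
    \sum_(i < n) k i *: s`_i = 0 /\ exists i, k i != 0.
  apply: contrapT => h; move/negP: nf; apply; apply/freeP => k ks i.
  by apply: contrapT => /eqP ki; apply: h; exists k; split=> //; exists i.
exists (\poly_(j < n) (k (inord j))).
  apply/eqP => /polyP /(_ i); rewrite coef_poly ltn_ord inord_val coef0.
  exact/eqP.
rewrite (@jevE _ _ n) ?size_poly // -[RHS]ks; apply: eq_bigr => j _.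
by rewrite coef_poly ltn_ord inord_val (nth_map j) ?size_enum_ord // nth_ord_enum.
Qed.

Lemma jsqr_eq0 x : x \jp x = 0 -> x = 0.
Proof.
move=> xx; apply/eqP; rewrite -inner_eq0 -{1}(jmulx1 x) jmul_inner xx.
by rewrite inner0r.
Qed.

Lemma inner_unit_sqr x : inner junit (x \jp x) = inner x x.
Proof. by rewrite -jmul_inner jmulx1. Qed.

(* A minimal annihilator of [z] in [R[z] z] has only real roots, since a sum of
   two squares vanishes only trivially; the root [0] is excluded as well because
   there are no nilpotents. *)
Lemma jev_eigen z : z != 0 ->
  exists l : R, exists2 p, l != 0 & jev z p != 0 /\ z \jp jev z p = l *: jev z p.
Proof.
move=> z0.
pose S n := exists p : {poly R}, [/\ size p = n, p != 0 & jev z (p * 'X) = 0].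
have exS : exists n, `[< S n >].
  have [p p0 zp] := jev_annul z; exists (size p); apply/asboolP; exists p.
  by split=> //; rewrite jevXM zp jmul0r.
case: (ex_minnP exS) => n /asboolP[p [sp p0 zp]] minn.
have {}minn (q : {poly R}) : q != 0 -> (size q < size p)%N -> jev z (q * 'X) != 0.
  move=> q0; rewrite sp; apply: contraTN => /eqP zq; rewrite -leqNgt.
  by apply: minn; apply/asboolP; exists q.
have p1 : (1 < size p)%N.
  rewrite ltnNge; apply/negP => /size1_polyC pE.
  move: zp p0; rewrite pE jevM jevC jevX jmulZl jmul1 polyC_eq0 => /eqP.
  by rewrite scaler_eq0 (negPf z0) orbF => ->.
have quot (q d : {poly R}) : p = q * d -> (1 < size d)%N -> jev z (q * 'X) != 0.
  move=> pE d1; have [q0 d0] : q != 0 /\ d != 0.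
    by apply/andP; rewrite -negb_or -mulf_eq0 -pE.
  apply: minn => //; rewrite pE size_mul //.
  by case: (size d) d1 => [|[|k]] // _; rewrite !addnS ltnS leq_addr.
have [[l /factor_theorem[q pE]]|[a [b [b0 /dvdpP[q pE]]]]] := real_poly_factor p1.
  have q0 := quot _ _ pE; rewrite size_XsubC in q0.
  have zl : z \jp jev z (q * 'X) = l *: jev z (q * 'X).
    apply/eqP; rewrite -subr_eq0; apply/eqP; rewrite -[RHS]zp pE -scaleNr.
    rewrite -jevXM -jevZ -jevD.
    by congr (jev z _); rewrite -mul_polyC polyCN; ring.
  exists l, (q * 'X); last by split=> //; exact: q0.
  (* If [l = 0] then [z^2 q(z) = 0], so [z q(z)] squares to zero and hence vanishes. *)
  apply: contraNneq (q0 isT) => l0; apply/eqP/jsqr_eq0.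
  rewrite l0 scale0r -jevXM in zl.
  rewrite -jevM (_ : _ * _ = q * (q * 'X * 'X)); last by ring.
  by rewrite jevM zl jmul0r.
set d := _ + _ in pE.
have d1 : (1 < size d)%N.
  rewrite /d size_polyDl ?size_exp_XsubC // size_polyC; by case: eqP.
have /eqP[] := quot _ _ pE d1.
(* Multiplying the annihilator [p X = q d X] by [q X] turns the factor [d] into a sum of two
   squares. Pairing with the unit then gives two squared norms adding up to 0, so [b z q(z) = 0],
   against minimality. *)
have : jev z (((q * 'X) * ('X - a%:P)) ^+ 2 + (b%:P * (q * 'X)) ^+ 2) = 0.
  rewrite (_ : _ + _ = (q * 'X) * (p * 'X)); last by rewrite pE /d polyC_exp; ring.
  by rewrite jevM zp jmul0r.
rewrite jevD !expr2 !(@jevM _ _ (_ * _)) => /(congr1 (inner junit)).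
rewrite innerDr !inner_unit_sqr inner0r => /eqP.
rewrite paddr_eq0 ?inner_ge0 // !inner_eq0 => /andP[_].
by rewrite jevM jevC jmulZl jmul1 scaler_eq0 (negPf b0) /= => /eqP.
Qed.

(** For an eigenvector [p(z)] of eigenvalue [l], [q(z) p(z) = q(l) p(z)] for every [q]. With [q = p]
    this excludes [p(l) = 0], as squares vanish only trivially, and makes [c = p(z) / p(l)]
    idempotent. Since [z c = l c], the square of [z (1 - c)] is [z^2 - l^2 c]. *)
Lemma jsqr_sub_idempotent z : z != 0 ->
  exists c w, exists2 t : R, 0 < t &
    [/\ jidempotent c, c <> 0 & z \jp z = t *: c + w \jp w].
Proof.
move=> /jev_eigen[l [p l0 [p0 zp]]].
have pq q : jev z q \jp jev z p = q.[l] *: jev z p.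
  elim/poly_ind: q => [|q c IH].
    by rewrite horner0 scale0r -polyC0 jevC scale0r jmul0l.
  rewrite jevD jevXM hornerMXaddC jevC jmulDl jmulZl jmul1 scalerDl; congr (_ + _).
  by rewrite (jmulC _ (jev z p)) jev_comm (jmulC (jev z p)) IH jmulZr zp scalerA.
have pl0 : p.[l] != 0.
  apply: contraNneq p0 => pl; apply/eqP/jsqr_eq0.
  by rewrite pq pl scale0r.
pose cp := p.[l]^-1 *: p.
have cpE : jev z cp = p.[l]^-1 *: jev z p.
  exact: jevZ.
have cc : jev z cp \jp jev z cp = jev z cp.
  by rewrite {2 3}cpE jmulZr pq hornerZ mulVf // scale1r.
have zc : z \jp jev z cp = l *: jev z cp.
  by rewrite cpE jmulZr zp !scalerA mulrC.
exists (jev z cp), (jev z ('X * (1 - cp))), (l ^+ 2).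
  by rewrite exprn_even_gt0.
split=> //.
  by rewrite cpE => /eqP; rewrite scaler_eq0 invr_eq0 (negPf pl0) (negPf p0).
have zzc : jev z ('X * 'X * cp) = l ^+ 2 *: jev z cp.
  by rewrite -mulrA jevM jevX jevM jevX zc jmulZr zc scalerA.
have ccE : jev z ('X * 'X * (cp * cp)) = l ^+ 2 *: jev z cp.
  by rewrite jevM (jevM _ cp) cc -jevM zzc.
rewrite -jevM (_ : 'X * _ * _ = 'X * 'X + (-1) *: ('X * 'X * cp)
    + (-1) *: ('X * 'X * cp) + 'X * 'X * (cp * cp)).
  rewrite !jevD !(jevZ z (-1)) zzc ccE.
  by rewrite jevM jevX !scaleN1r subrK [RHS]addrC subrK.
by rewrite -!mul_polyC polyCN; ring.
Qed.
End Powers.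

(** * Riesz representation and boundedness of linear maps *)

Section FiniteDimension.
Context {R : realType} {X : euclideanType R}.
Implicit Types x y : X.

(** The coordinates of [g] solve a linear system whose matrix is the Gram matrix of a basis. It is
    invertible: a kernel vector would give an element orthogonal to the whole space. *)
Lemma riesz (f : X -> R) :
  (forall (a : R) x y, f (a *: x + y) = a * f x + f y) ->
  exists g : X, forall x, inner g x = f x.
Proof.
move=> flin.
have f0 : f 0 = 0.
  have := flin 1 0 0; rewrite scale1r addr0 mul1r => /eqP.
  by rewrite -subr_eq0 opprD addrA subrr sub0r oppr_eq0 => /eqP.
have fsum n (k : 'I_n -> R) (s : 'I_n -> X) :
    f (\sum_i k i *: s i) = \sum_i k i * f (s i).
  elim/big_rec2: _ => [//|i y1 y2 _ <-]; exact: flin.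
set n := \dim {:X}; pose e (i : 'I_n) : X := (vbasis {:X})`_i.
have xE x : x = \sum_i coord (vbasis {:X}) i x *: e i.
  by apply: coord_vbasis; rewrite memvf.
pose gram := \matrix_(i < n, j < n) inner (e i) (e j).
have gram_unit : gram \in unitmx.
  rewrite -row_free_unit -kermx_eq0; apply/rowV0P => v /sub_kermxP vg.
  pose x := \sum_i v 0 i *: e i.
  have x0 : x = 0.
    apply: inner_inj => w; rewrite inner0l (xE w) inner_sumr big1 // => j _.
    rewrite innerZr [X in _ * X](_ : _ = (v *m gram) 0 j).
      by rewrite vg mxE mulr0.
    rewrite mxE /x inner_suml; apply: eq_bigr => i _.
    by rewrite innerZl mxE.
  apply/rowP => i; rewrite mxE.
  have /freeP := basis_free (vbasisP {:X}); apply; exact: x0.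
pose c := (\row_j f (e j)) *m invmx gram.
exists (\sum_i c 0 i *: e i) => x.
rewrite [in RHS](xE x) fsum [in LHS](xE x) inner_sumr.  apply: eq_bigr => j _.
rewrite innerZr; congr (_ * _).
transitivity ((c *m gram) 0 j); last by rewrite /c mulmxKV // mxE.
rewrite mxE inner_suml; apply: eq_bigr => i _.
by rewrite innerZl [gram _ _]mxE.
Qed.

(** Each coordinate is an inner product with a Riesz vector, so Cauchy-Schwarz bounds it; [K] is the
    sum of the norms of these vectors. *)
Lemma coord_bound : exists2 K : R, 0 <= K &
  forall x (i : 'I_(\dim {:X})), `|coord (vbasis {:X}) i x| <= K * `|x|.
Proof.
have /choice[g gP] (i : 'I_(\dim {:X})) :
    exists g : X, forall x, inner g x = coord (vbasis {:X}) i x.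
  by apply: riesz => a x y; rewrite linearP.
exists (\sum_i `|g i|) => [|x i]; first by apply: sumr_ge0 => i _.
rewrite -gP (le_trans (norm_inner_le _ _)) // ler_wpM2r //.
by rewrite (bigD1 i) //= lerDl sumr_ge0.
Qed.

Lemma linear_bound (W : normedModType R) (L : {linear X -> W}) :
  exists2 C : R, 0 <= C & forall x, `|L x| <= C * `|x|.
Proof.
have [K K0 KP] := coord_bound.
pose e (i : 'I_(\dim {:X})) : X := (vbasis {:X})`_i.
exists (\sum_i K * `|L (e i)|) => [|x].
  by apply: sumr_ge0 => i _; rewrite mulr_ge0.
rewrite {1}(coord_vbasis (memvf x)) linear_sum (le_trans (ler_norm_sum _ _ _)) //.
rewrite mulr_suml; apply: ler_sum => i _.
by rewrite linearZ normrZ mulrAC ler_wpM2r.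
Qed.

Lemma linear_continuous_findim (W : normedModType R) (L : {linear X -> W}) :
  continuous L.
Proof.
have [C C0 CP] := linear_bound L.
apply/linear_bounded_continuous/linear_boundedP.
near=> r => x; rewrite (le_trans (CP x)) // ler_wpM2r //.
Unshelve. all: by end_near. Qed.

Lemma adjoint (W : euclideanType R) (L : {linear X -> W}) (w : W) :
  exists g : X, forall x, inner g x = inner w (L x).
Proof.
apply: riesz => a x y.
by rewrite linearP innerDr innerZr.
Qed.
End FiniteDimension.

(** * Size and splitting of idempotents *)

Section Idempotents.
Context {R : realType} {X : ejaType R}.
Implicit Types a b c x y : X.

Lemma jmul_bound : exists2 M : R, 0 <= M &
  forall x y, `|jmul x y| <= M * `|x| * `|y|.
Proof.
have [K K0 KP] := @coord_bound R X.
pose e (i : 'I_(\dim {:X})) : X := (vbasis {:X})`_i.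
have /choice[C CP] i : exists C : R, 0 <= C /\ forall y, `|jmul (e i) y| <= C * `|y|.
  by have [C C0 CP] := linear_bound (jmul (e i)); exists C.
exists (\sum_i K * C i) => [|x y].
  by apply: sumr_ge0 => i _; rewrite mulr_ge0 // (CP i).1.
rewrite {1}(coord_vbasis (memvf x)) (linear_sumlz jmul).
rewrite (le_trans (ler_norm_sum _ _ _)) // !mulr_suml; apply: ler_sum => i _.
rewrite jmulZl normrZ.
rewrite (_ : K * C i * `|x| * `|y| = (K * `|x|) * (C i * `|y|)); last by ring.
by rewrite ler_pM ?(CP i).2.
Qed.

(** From [|c| <= M |c|^2] one gets a lower bound on [|c|]; [M + 1] keeps the constant positive even
    for [M = 0]. *)
Lemma idempotent_norm_ge : exists2 d : R, 0 < d &
  forall c, jidempotent c -> c <> 0 -> d <= inner c c.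
Proof.
have [M M0 MP] := jmul_bound.
exists ((M + 1) ^- 2); first by rewrite invr_gt0 exprn_gt0 // ltr_wpDl.
move=> c cc /eqP c0.
have nc : 0 < `|c| by rewrite normr_gt0.
have h : (M + 1)^-1 <= `|c|.
  rewrite -div1r ler_pdivrMr ?ltr_wpDl //.
  have := MP c c; rewrite cc -mulrA => h.
  rewrite -(ler_pM2r nc) mul1r (le_trans h) //; nra.
by rewrite inner_normE -exprVn lerXn2r // nnegrE ?invr_ge0 ?addr_ge0.
Qed.

(* The summands of an idempotent multiply to zero, hence are orthogonal. *)
Lemma idempotent_split a b c : jidempotent a -> jidempotent b ->
  jidempotent c -> c = a + b -> inner c c = inner a a + inner b b.
Proof.
move=> aa bb cc cE; move: (cc); rewrite /jidempotent cE jmulDl !jmulDr aa bb.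
rewrite (jmulC b a) => h.
have ab : jmul a b = 0.
  have : 2%:R *: jmul a b = 0.
    move/eqP: h; rewrite [_ + b in X in X == _]addrC addrACA.
    rewrite -[X in _ == X]addr0 (inj_eq (addrI _)).
    by rewrite scaler_nat mulr2n => /eqP.
  by move/eqP; rewrite scaler_eq0 pnatr_eq0 /= => /eqP.
have iab : inner a b = 0 by rewrite -[X in inner X b]aa jmul_inner ab inner0r.
by rewrite !innerE (innerC b a) iab addr0 add0r.
Qed.
End Idempotents.

(** * Convex cones and first-order optimality on the unit sphere *)

Section ConvexCone.
Context {R : realType} {V : euclideanType R}.
Implicit Types (P : set V) (u v w : V).

(** The sum is twice the midpoint, which lies in [P] by convexity. *)
Lemma cone_add P u v : closed_convex_cone P -> P u -> P v -> P (u + v).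
Proof.
move=> [_ cvP _ cP] Pu Pv.
have h0 : 0 <= 2^-1 :> R by rewrite invr_ge0.
have h1 : 2^-1 <= 1 :> R by rewrite invf_le1 // ler1n.
have := cvP u v (Itv01 h0 h1); rewrite !inE => /(_ Pu Pv).
have -> : conv (Itv01 h0 h1) (u : convex_lmodType V) (v : convex_lmodType V) =
    2^-1 *: u + 2^-1 *: v.
  congr (_ + _ *: _); change (1 - 2^-1 = 2^-1 :> R); by field.
move=> /(cP 2 _ (ler0n _ _)).
by rewrite scalerDr !scalerA divff ?pnatr_eq0 // !scale1r.
Qed.

Lemma normalizeE u : u = `|u| *: normalize u.
Proof.
have [->|u0] := eqVneq u 0; first by rewrite normr0 scale0r.
by rewrite /normalize scalerA divff ?normr_eq0 // scale1r.
Qed.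

Lemma norm_normalize u : u != 0 -> `|normalize u| = 1.
Proof.
by move=> u0; rewrite /normalize normrZ normfV normr_id mulVf // normr_eq0.
Qed.

Lemma normalizeZ (t : R) u : 0 < t -> normalize (t *: u) = normalize u.
Proof.
move=> t0; rewrite /normalize normrZ gtr0_norm // invfM scalerA mulrAC.
by rewrite mulVf ?mul1r // gt_eqF.
Qed.

Lemma normalize_unit u : `|u| = 1 -> normalize u = u.
Proof. by move=> u1; rewrite /normalize u1 invr1 scale1r. Qed.

Lemma inner_normalize u v :
  inner (normalize u) (normalize v) = inner u v / (`|u| * `|v|).
Proof. by rewrite /normalize innerZl innerZr invfM mulrA mulrC. Qed.

(** By homogeneity, minimality extends to [s |z| <= <z,v>] on all of [P], with [s = <u,v>]. Testing
    it at [z = u + t w] and comparing first-order terms in [t] gives the claim. *)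
Lemma minimizer_dual P u v : closed_convex_cone P -> P u -> `|u| = 1 ->
  (forall u', P u' -> `|u'| = 1 -> inner u v <= inner u' v) ->
  dual_cone P (v - inner u v *: u).
Proof.
move=> coneP Pu u1 umin w Pw.
have [_ _ _ cP] := coneP.
set s := inner u v in umin *.
have hom z : P z -> s * `|z| <= inner z v.
  move=> Pz; have [->|z0] := eqVneq z 0; first by rewrite normr0 mulr0 inner0l.
  have nz : 0 < `|z| by rewrite normr_gt0.
  rewrite [in leRHS](normalizeE z) innerZl mulrC ler_pM2l //.
  by apply: umin; [apply: cP; rewrite ?invr_ge0|apply: norm_normalize].
have uu : inner u u = 1 by rewrite inner_normE u1 expr1n.
have step t : 0 < t -> s * `|u + t *: w| <= s + t * inner w v.
  move=> t0; have := hom (u + t *: w); rewrite innerDl innerZl -/s; apply.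
  by apply: cone_add => //; apply: cP => //; exact: ltW.
rewrite innerDl innerNl innerZl (innerC v).
have [s0|s0] := leP 0 s.
  (* For [s >= 0] only the lower bound [|u + w| >= 1 + <u,w>] is needed, and [t = 1] suffices. *)
  have := step 1 ltr01; rewrite scale1r mul1r => h.
  have := inner_le_norm u (u + w); rewrite u1 mul1r innerDr uu => h2.
  by have := ler_wpM2l s0 h2; lra.
(* [2 |z| <= |z|^2 + 1] gives a first-order upper bound on the norm *)
have quad t : 0 < t -> s * t * (inner w w) / 2 <= inner w v - s * inner u w.
  move=> t0; have := step t t0; set n := `|_|.
  have nE : n ^+ 2 = 1 + 2 * t * inner u w + t ^+ 2 * inner w w.
    rewrite /n -inner_normE !innerE uu (innerC w u); ring.
  have := sqr_ge0 (n - 1) => n1 h.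
  have h2 : s * (n ^+ 2 + 1) / 2 <= s * n.
    rewrite -mulrA ler_nM2l //; lra.
  by rewrite -(ler_pM2l t0); move: h2; rewrite nE; lra.
rewrite leNgt; apply/negP; set D := _ - _; rewrite -/D in quad.
move=> D0; have w0 := inner_ge0 w.
(* At [t = - D / (2 c)] the left side of [quad] equals [(c - 1) / c * D / 2], which exceeds the
   negative [D]. *)
pose c := - s * inner w w / 2 + 1.
have c1 : 1 <= c by rewrite /c; nra.
have := quad (- D / (2 * c)); rewrite divr_gt0 ?oppr_gt0 //; last by lra.
move=> /(_ isT).
rewrite (_ : s * _ * _ / 2 = (c - 1) / c * D / 2); last by rewrite /c; field; nra.
have : (c - 1) / c < 1 by rewrite ltr_pdivrMr; lra.
by set r := _ / c; nra.
Qed.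
End ConvexCone.

(** * LISC cones: injectivity at zero and lifting of unit vectors *)

Section LISC.
Context {R : realType} {X : ejaType R} {V : euclideanType R}.
Context (G : {linear X -> V}) (P : set V) (hP : LISC_cone G P).

Lemma lisc_cone_image x : symmetric_cone X x -> P (G x).
Proof. by case: hP => _ -> _ _ Kx; exists x. Qed.

Lemma lisc_pointed (u v : V) : P u -> P v -> u + v = 0 -> u = 0.
Proof.
move=> Pu Pv /eqP; rewrite addr_eq0 => /eqP uv.
case: hP => _ _ _ pt; have : (P `&` [set - u | u in P])%classic u.
  by split=> //; exists v.
by rewrite pt.
Qed.

Lemma lisc_idempotent_neq0 c : jidempotent c -> c <> 0 -> G c <> 0.
Proof.
have [d d0 dP] := @idempotent_norm_ge R X.
have sq a : jidempotent a -> P (G a).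
  by move=> aa; apply: lisc_cone_image; exists a.
(* Each splitting lowers the squared norm by at least [d], so the number of multiples of [d]
   covering it is the induction measure. *)
suff H n : forall c, jidempotent c -> c <> 0 -> inner c c <= n%:R * d -> G c <> 0.
  move=> cc c0; apply: (H (Num.bound (inner c c / d))) => //.
  rewrite -ler_pdivrMr //; apply/ltW/archi_boundP.
  by rewrite divr_ge0 ?inner_ge0 ?ltW.
elim: n => [|n IH] {}c cc c0 cn Gc.
  by apply: c0; apply/eqP; rewrite -inner_eq0 eq_le inner_ge0 andbT -(mul0r d).
have [_ _ prim _] := hP; apply: (prim c) => //; split=> // -[a [b]].
move=> [aa a0 bb b0 cE].
have Ga : G a = 0.
  by apply: (lisc_pointed (sq a aa) (sq b bb)); rewrite -linearD -cE.
apply: (IH a) => //.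
have := idempotent_split aa bb cc cE; have := dP b bb b0.
by rewrite -natr1 mulrDl mul1r in cn; lra.
Qed.

Lemma lisc_ker x : symmetric_cone X x -> G x = 0 -> x = 0.
Proof.
move=> [z _ <-] Gz; apply: contrapT => zz0.
have z0 : z != 0 by apply: contra_notN zz0 => /eqP ->; rewrite jmul0l.
have [c [w [t t0 [cc c0 zE]]]] := jsqr_sub_idempotent z0.
apply: (lisc_idempotent_neq0 cc c0).
have Pc : P (G c) by apply: lisc_cone_image; exists c.
have [[_ _ _ cP] _ _ _] := hP.
have := @lisc_pointed (t *: G c) (G (jmul w w)).
rewrite -linearZ -linearD -zE => /(_ _ _ Gz) h.
have /eqP : G (t *: c) = 0.
  apply: h; last by apply: lisc_cone_image; exists w.
  by rewrite linearZ; apply: cP => //; exact: ltW.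
by rewrite linearZ scaler_eq0 gt_eqF //= => /eqP.
Qed.

(** Rescale a preimage [z^2] of [u] by [<e,z^2> = |z|^2], which is positive since [u] is nonzero;
    [normalize] ignores positive factors. *)
Lemma lisc_lift (u : V) : P u -> `|u| = 1 -> exists x,
  [/\ symmetric_cone X x, inner junit x = 1 & u = normalize (G x)].
Proof.
move=> Pu u1; have [_ PE _ _] := hP; move: Pu; rewrite PE => -[_ [z _ <-] Gz].
have t0 : 0 < inner junit (jmul z z).
  rewrite inner_unit_sqr lt_def inner_ge0 inner_eq0 andbT.
  apply/eqP => z0; move: u1; rewrite -Gz z0 jmul0l linear0 normr0 => /eqP.
  by rewrite eq_sym oner_eq0.
set t := inner _ _ in t0.
exists (t^-1 *: jmul z z); split.
- exists (Num.sqrt t^-1 *: z) => //.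
  by rewrite jmulZl jmulZr scalerA -expr2 sqr_sqrtr // invr_ge0 ltW.
- by rewrite innerZr mulVf // gt_eqF.
- by rewrite linearZ normalizeZ ?invr_gt0 // Gz normalize_unit.
Qed.

Lemma lisc_neq0 x : symmetric_cone X x -> inner junit x = 1 -> G x != 0.
Proof.
move=> Kx x1; apply/eqP => /(lisc_ker Kx) x0; move: x1; rewrite x0 inner0r.
by move/eqP; rewrite eq_sym oner_eq0.
Qed.
End LISC.

Lemma orthogonal_residual (R : realType) (V : euclideanType R) (u v : V) :
  `|u| = 1 -> inner (v - inner u v *: u) u = 0.
Proof.
move=> u1; rewrite innerDl innerNl innerZl inner_normE u1 expr1n mulr1.
by rewrite innerC subrr.
Qed.

(** * Gradients of the norm and of the ratio *)

Section Gradient.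
Context {R : realType} {X V : euclideanType R}.

Lemma gradient_unique (f : X -> R) x g g' :
  is_gradient f x g -> is_gradient f x g' -> g = g'.
Proof.
move=> [_ dg] [_ dg']; apply: inner_inj => w.
by rewrite -dg dg'.
Qed.

(** A quadratic remainder is [o(h)], and [inner g] is continuous in finite dimension, so uniqueness
    of the differential identifies it. *)
Lemma is_gradient_quadratic (f : X -> R) x g (C : R) :
  (forall h, `|f (h + x) - f x - inner g h| <= C * `|h| ^+ 2) ->
  is_gradient f x g.
Proof.
move=> fq.
have glin : linear (inner g : X -> R) by move=> a u v; rewrite innerDr innerZr.
pose gM := GRing.isLinear.Build _ _ _ _ _ glin.
pose gL : {linear X -> R} := HB.pack (inner g : X -> R) gM.
have gc : continuous gL by exact: linear_continuous_findim.
have fo : f \o shift x = cst (f x) + gL +o_ 0 id.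
  apply/eqaddoP => _/posnumP[e].
  (* The sign of [C] is unknown, so [|C| + 1] serves as a positive bound. *)
  have C1 : 0 < `|C| + 1 by rewrite ltr_wpDl.
  near=> h; rewrite /= opprD addrA (le_trans (fq h)) // expr2 mulrA ler_wpM2r //.
  have hC : (`|C| + 1) * `|h| <= e%:num.
    rewrite -ler_pdivlMl //; near: h; apply: nbhs0_le.
  rewrite (le_trans _ hC) // ler_wpM2r // (le_trans (ler_norm C)) // lerDl.
  exact: ler01.
have dE : 'd f x = inner g :> (X -> R) by exact: (diff_unique gc fo).
split=> //; apply/diff_locallyP; split; rewrite dE //.
Unshelve. all: by end_near. Qed.

(** With [n = |h + v|], [a = |v|], [b = |h|], the remainder is exactly [(b^2 - (n - a)^2) / (2 a)],
    and [|n - a| <= b]. *)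
Lemma norm_quadratic (v h : V) : v != 0 ->
  `| `|h + v| - `|v| - inner (normalize v) h| <= (2 * `|v|)^-1 * `|h| ^+ 2.
Proof.
rewrite -normr_gt0 /normalize innerZl; set a := `|v| => a0.
have := inner_normE (h + v); rewrite !innerE !inner_normE (innerC h v) -/a.
set n := `|h + v|; set s := inner v h; set b := `|h| => E.
have nab : (n - a) ^+ 2 <= b ^+ 2.
  rewrite -real_normK ?num_real // lerXn2r ?nnegrE ?normr_ge0 //.
  by rewrite (le_trans (ler_dist_dist (h + v) v)) // addrK.
have -> : n - a - a^-1 * s = (2 * a)^-1 * (b ^+ 2 - (n - a) ^+ 2).
  rewrite (_ : s = (n ^+ 2 - a ^+ 2 - b ^+ 2) / 2); last by rewrite -E; field.
  by field; rewrite gt_eqF.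
have k0 : 0 < (2 * a)^-1 by rewrite invr_gt0 mulr_gt0.
rewrite normrM (gtr0_norm k0) ler_pM2l // ger0_norm ?subr_ge0 //.
by rewrite lerBlDr lerDl sqr_ge0.
Qed.

(** The condition on [g] says that it is the adjoint of [G] applied to the part of [normalize w]
    orthogonal to [G x], divided by [|G x|]: the derivative given by the product rule. *)
Lemma ratio_gradient (G : {linear X -> V}) (w : V) x g : G x != 0 -> w != 0 ->
  (forall k, inner g k =
    `|G x|^-1 *
    inner (normalize w - inner (normalize (G x)) (normalize w) *: normalize (G x))
      (G k)) ->
  is_gradient (fun x => inner (G x) w / (`|G x| * `|w|)) x g.
Proof.
move=> Gx0 w0 gE.
have a0 : `|G x| != 0 by rewrite normr_eq0.
have b0 : `|w| != 0 by rewrite normr_eq0.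
have [p pE] := adjoint G w.
have [q qE] := adjoint G (normalize (G x)).
have dnum : is_gradient (fun y => inner (G y) w) x p.
  apply: (@is_gradient_quadratic _ _ _ 0) => h.
  by rewrite linearD innerDl addrK pE innerC subrr normr0 mul0r.
have dden : is_gradient (fun y => `|G y|) x q.
  have [C C0 CP] := linear_bound G.
  apply: (@is_gradient_quadratic _ _ _ ((2 * `|G x|)^-1 * C ^+ 2)) => h.
  rewrite linearD qE (le_trans (norm_quadratic _ Gx0)) // -mulrA -exprMn.
  rewrite ler_wpM2l ?invr_ge0 ?mulr_ge0 // lerXn2r ?nnegrE ?mulr_ge0 //.
have dinv : is_diff x (fun y => (`|G y|)^-1) (- (`|G x|) ^- 2 \*: inner q).
  have [dd de] := dden; apply: DiffDef; first exact: differentiableV.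
  by rewrite diffV // de.
have dmul := is_diffZ (`|w|^-1) (is_diffM dnum dinv).
rewrite /is_gradient (_ : (fun _ => _) =
  `|w|^-1 *: ((fun y => inner (G y) w) * (fun y => (`|G y|)^-1))); last first.
  by apply/funext => y; rewrite /= invfM mulrA [LHS]mulrC.
apply: is_diff_eq dmul _; apply/funext => k.
rewrite gE /=.
rewrite -[LHS]/(`|w|^-1 *
  (inner (G x) w * (- (`|G x|) ^- 2 * inner q k) + (`|G x|)^-1 * inner p k)).
rewrite pE qE /normalize !innerE; field.
by rewrite a0 b0.
Qed.
End Gradient.

(** * Stationarity in one variable as dual cone membership *)

Section Half.
Context {R : realType} {X : ejaType R} {V : euclideanType R}.
Context (G : {linear X -> V}) (P : set V) (hP : LISC_cone G P).

Lemma unit_constraint_gradient x :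
  is_gradient (fun x : X => inner junit x - 1) x junit.
Proof.
apply: (@is_gradient_quadratic _ _ _ _ _ 0) => h.
by rewrite innerDr (_ : _ - _ - _ = 0) ?normr0 ?mul0r //; ring.
Qed.

(* Pairing the stationarity condition with [x] forces the multiplier to vanish,
   because the ratio is homogeneous of degree zero. *)
Lemma stationary_half (w : V) x : w != 0 -> symmetric_cone X x ->
    inner junit x = 1 ->
  (exists gamma g d,
    [/\ is_gradient (fun x => inner (G x) w / (`|G x| * `|w|)) x g,
        is_gradient (fun x : X => inner junit x - 1) x d,
        dual_cone (symmetric_cone X) (g + gamma *: d) &
        inner x (g + gamma *: d) = 0]) <->
  dual_cone P
    (normalize w - inner (normalize (G x)) (normalize w) *: normalize (G x)).
Proof.
move=> w0 Kx x1; set z := _ - _ *: _.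
have Gx0 := lisc_neq0 hP Kx x1.
have a0 : 0 < `|G x|^-1 by rewrite invr_gt0 normr_gt0.
have [g gE] := adjoint G (`|G x|^-1 *: z).
have gz k : inner g k = `|G x|^-1 * inner z (G k) by rewrite gE innerZl.
have dg := ratio_gradient Gx0 w0 gz.
(* Euler's identity in degree zero: the residual [z] is orthogonal to [G x]. *)
have xg : inner g x = 0.
  rewrite gz (normalizeE (G x)) innerZr /z orthogonal_residual ?mulr0 //.
  exact: norm_normalize.
have PE : P = (G @` symmetric_cone X)%classic by case: hP.
split=> [[gamma [g' [d [dg' dd dual ortho]]]]|dual].
  have gg := gradient_unique dg' dg.
  have de := gradient_unique dd (unit_constraint_gradient x).
  (* Orthogonality to [x] reduces to [gamma = 0], because [<e,x> = 1]. *)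
  move: ortho dual; rewrite gg de innerDr innerZr (innerC x) xg add0r.
  rewrite (innerC x) x1 mulr1 => ->; rewrite scale0r addr0 => dual.
  move=> u; rewrite PE => -[k Kk <-].
  by rewrite -(pmulr_rge0 _ a0) -gz; apply: dual.
exists 0, g, junit; rewrite scale0r addr0; split=> //.
- exact: unit_constraint_gradient.
- by move=> k Kk; rewrite gz pmulr_rge0 //; apply: dual; apply: (lisc_cone_image hP).
- by rewrite innerC.
Qed.
End Half.

(** * Correspondence between the fractional program and pairs of unit vectors *)

Section Main.
Context {R : realType} {V : euclideanType R} {X Y : ejaType R}.
Context (G : {linear X -> V}) (H : {linear Y -> V}) (P Q : set V).
Context (hP : LISC_cone G P) (hQ : LISC_cone H Q).

Lemma FP_objectiveE x y :
  FP_objective G H x y = inner (normalize (G x)) (normalize (H y)).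
Proof. by rewrite inner_normalize. Qed.

Lemma FP_unit_pair x y :
  symmetric_cone X x -> inner junit x = 1 ->
  symmetric_cone Y y -> inner junit y = 1 ->
  unit_pair P Q (normalize (G x)) (normalize (H y)).
Proof.
move=> Kx x1 Ky y1.
have Gx0 := lisc_neq0 hP Kx x1; have Hy0 := lisc_neq0 hQ Ky y1.
have [[_ _ _ cP] _ _ _] := hP; have [[_ _ _ cQ] _ _ _] := hQ.
split; rewrite ?norm_normalize //.
- by apply: cP; rewrite ?invr_ge0 //; apply: lisc_cone_image hP _ Kx.
- by apply: cQ; rewrite ?invr_ge0 //; apply: lisc_cone_image hQ _ Ky.
Qed.

Lemma FP_stationaryP x y :
  symmetric_cone X x -> inner junit x = 1 ->
  symmetric_cone Y y -> inner junit y = 1 ->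
  FP_stationary G H x y <->
  critical_pair P Q (normalize (G x)) (normalize (H y)).
Proof.
move=> Kx x1 Ky y1.
have Gx0 := lisc_neq0 hP Kx x1; have Hy0 := lisc_neq0 hQ Ky y1.
have halfX := stationary_half hP Hy0 Kx x1.
have halfY := stationary_half hQ Gx0 Ky y1.
(* The objective is symmetric in its two arguments, so the condition in [y] is [stationary_half]
   with the cones exchanged. *)
have swap : FP_objective G H x =
    (fun y => inner (H y) (G x) / (`|H y| * `|G x|)).
  by apply/funext => y'; rewrite /FP_objective innerC [X in _ / X]mulrC.
split.
  move=> [g1 [g2 [gx [d1 [gy [d2 [[dgx dd1 dgy dd2] [_ dual1 o1] [_ dual2 o2] _]]]]]]].
  split; first exact: FP_unit_pair.
    by apply/halfX; exists g1, gx, d1; split.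
  rewrite innerC; apply/halfY; exists g2, gy, d2; split=> //.
  by rewrite -swap.
move=> [_ /halfX[g1 [gx [d1 [? ? ? ?]]]]].
rewrite innerC => /halfY[g2 [gy [d2 [dgy ? ? ?]]]].
exists g1, g2, gx, d1, gy, d2; split; split=> //.
- by rewrite swap.
- by rewrite x1 subrr.
- by rewrite y1 subrr.
Qed.

Lemma FP_feasibleP x y :
  feasible (fun x : X => inner junit x - 1) (fun y : Y => inner junit y - 1) x y
  <-> [/\ symmetric_cone X x, inner junit x = 1,
          symmetric_cone Y y & inner junit y = 1].
Proof.
split=> [[Kx /eqP + Ky /eqP]|[Kx x1 Ky y1]]; last by split; rewrite ?x1 ?y1 ?subrr.
by rewrite !subr_eq0 => /eqP ? /eqP ?.
Qed.

(** Normalized images of feasible pairs are exactly the unit pairs, by [FP_unit_pair] and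
    [lisc_lift], and the objective is the inner product of these images. *)
Lemma FP_solutionP x y :
  symmetric_cone X x -> inner junit x = 1 ->
  symmetric_cone Y y -> inner junit y = 1 ->
  FP_solution G H x y <->
  antipodal_pair P Q (normalize (G x)) (normalize (H y)).
Proof.
move=> Kx x1 Ky y1; split=> [[_ opt]|[_ opt]].
  split=> [|u v [Pu u1 Qv v1]]; first exact: FP_unit_pair.
  have [x' [Kx' x'1 ->]] := lisc_lift hP Pu u1.
  have [y' [Ky' y'1 ->]] := lisc_lift hQ Qv v1.
  by rewrite -!FP_objectiveE; apply/opt/FP_feasibleP.
split=> [|x' y' /FP_feasibleP[Kx' x'1 Ky' y'1]]; first exact/FP_feasibleP.
by rewrite !FP_objectiveE; apply/opt/FP_unit_pair.
Qed.

(** Freezing one component leaves a linear form minimized over the unit vectors of one cone, so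
    [minimizer_dual] applies to each component in turn. *)
Lemma antipodal_critical u v : antipodal_pair P Q u v -> critical_pair P Q u v.
Proof.
move=> [[Pu u1 Qv v1] opt].
have [cP _ _ _] := hP; have [cQ _ _ _] := hQ.
split=> //; first by apply: minimizer_dual => // u' Pu' u'1; apply: opt.
rewrite innerC; apply: minimizer_dual => // v' Qv' v'1.
by rewrite innerC (innerC v'); apply: opt.
Qed.
End Main.

Theorem corollary2 (R : realType) (V : euclideanType R) (X Y : ejaType R)
    (G : {linear X -> V}) (H : {linear Y -> V}) (P Q : set V)
    (scalX : scalarizable X) (scalY : scalarizable Y)
    (hP : LISC_cone G P) (hQ : LISC_cone H Q)
    (ntP : nontrivial_closed_convex_cone P)
    (ntQ : nontrivial_closed_convex_cone Q) :
  [/\ forall (x : X) (y : Y), FP_stationary G H x y ->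
        critical_pair P Q (normalize (G x)) (normalize (H y)),
      forall (x : X) (y : Y), FP_solution G H x y ->
        antipodal_pair P Q (normalize (G x)) (normalize (H y)),
      forall u v : V, critical_pair P Q u v ->
        exists (x : X) (y : Y),
          [/\ FP_stationary G H x y, u = normalize (G x) & v = normalize (H y)] &
      forall u v : V, antipodal_pair P Q u v ->
        exists (x : X) (y : Y),
          [/\ FP_stationary G H x y, FP_solution G H x y,
              u = normalize (G x) & v = normalize (H y)]].
Proof.
(* For the converse parts, every unit pair comes from a feasible pair; the equivalences at that pair
   then transfer the property. *)
have lift u v : unit_pair P Q u v -> exists (x : X) (y : Y),
    [/\ [/\ symmetric_cone X x, inner junit x = 1,
            symmetric_cone Y y & inner junit y = 1],
        u = normalize (G x) & v = normalize (H y)].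
  move=> [Pu u1 Qv v1].
  have [x [Kx x1 uE]] := lisc_lift hP Pu u1.
  have [y [Ky y1 vE]] := lisc_lift hQ Qv v1.
  by exists x, y.
split.
- move=> x y st; move: (st).
  move=> [_ [_ [_ [_ [_ [_ [_ [Kx _ _] [Ky _ _] [/eqP + /eqP]]]]]]]].
  rewrite !subr_eq0 => /eqP x1 /eqP y1.
  exact/(FP_stationaryP hP hQ Kx x1 Ky y1).
- move=> x y sol; have [/FP_feasibleP[Kx x1 Ky y1] _] := sol.
  exact/(FP_solutionP hP hQ Kx x1 Ky y1).
- move=> u v crit; have [/lift[x [y [[Kx x1 Ky y1] uE vE]]] _ _] := crit.
  exists x, y; split=> //.
  by apply/(FP_stationaryP hP hQ Kx x1 Ky y1); rewrite -uE -vE.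
- move=> u v anti; have [/lift[x [y [[Kx x1 Ky y1] uE vE]]] _] := anti.
  exists x, y; split=> //.
    apply/(FP_stationaryP hP hQ Kx x1 Ky y1); rewrite -uE -vE.
    exact: (antipodal_critical hP hQ).
  by apply/(FP_solutionP hP hQ Kx x1 Ky y1); rewrite -uE -vE.
Qed.
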